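(* (a) The set of sequences $(f_k)_{k\in\omega}\in\mathcal P^\omega$ of everywhere converging martingales whose associated functions $(\psi(f_k))_{k\in\omega}$ converge pointwise on $2^\omega$ is ${\bf\Pi}^1_1$-complete. (b) The set of sequences $(f_k)_{k\in\omega}\in\mathcal P^\omega$ of everywhere converging martingales whose associated functions $(\psi(f_k))_{k\in\omega}$ converge pointwise to zero on $2^\omega$ is ${\bf\Pi}^1_1$-complete. (c) The set of sequences $(f_k)_{k\in\omega}\in\mathcal P^\omega$ of everywhere converging martingales having a subsequence $(f_{k_i})_{i\in\omega}$ (with $k_0<k_1<\cdots$) whose associated functions $(\psi(f_{k_i}))_{i\in\omega}$ converge pointwise to zero on $2^\omega$ is ${\bf\Sigma}^1_2$-complete.
   Context: $2^{<\omega}$ is the set of finite binary sequences, $2^\omega$ the Cantor space; for $\beta\in 2^\omega$, $\beta|l$ is the initial segment of $\beta$ of length $l$. A martingale is a map $f:2^{<\omega}\to[0,1]$ such that $f(s)=\frac{f(s0)+f(s1)}{2}$ for each $s\in 2^{<\omega}$. The set $\mathcal M$ of martingales is a compact subset of $[0,1]^{2^{<\omega}}$ (product topology). A martingale $f$ is everywhere converging if $(f(\beta|l))_{l\in\omega}$ converges for every $\beta\in2^\omega$; $\mathcal P\subseteq\mathcal M$ is the set of such martingales. For $f\in\mathcal P$, the associated function $\psi(f):2^\omega\to[0,1]$ is $\psi(f)(\beta):=\lim_{l\to\infty}f(\beta|l)$. The sets in the statement are regarded as subsets of the Polish space $\mathcal M^\omega$. A subset $C$ of a Polish space $X$ is ${\bf\Gamma}$-complete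 if $C\in{\bf\Gamma}(X)$ and for every zero-dimensional Polish space $Z$ and every $D\in{\bf\Gamma}(Z)$ there is a continuous $g:Z\to X$ with $D=g^{-1}(C)$. *)

(* Defs.v *)
From HB Require Import structures.
From mathcomp Require Import all_boot all_order all_algebra.
From mathcomp Require Import all_classical all_reals all_analysis.

Set Implicit Arguments.
Unset Strict Implicit.
Unset Printing Implicit Defensive.

Import Order.TTheory GRing.Theory Num.Theory.
Import numFieldNormedType.Exports.

Local Open Scope classical_set_scope.
Local Open Scope ring_scope.

Section descriptive_set_theory.
Variable R : realType.

Definition is_metric (T : Type) (d : T -> T -> R) : Prop :=
  [/\ forall x y, 0 <= d x y,
      forall x y, d x y = 0 <-> x = y,
      forall x y, d x y = d y x &
      forall x y z, d x z <= d x y + d y z].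

Definition metric_compatible (T : topologicalType) (d : T -> T -> R) : Prop :=
  forall (x : T) (A : set T),
    nbhs x A <-> exists2 e : R, 0 < e & [set y | d x y < e] `<=` A.

Definition metric_complete (T : topologicalType) (d : T -> T -> R) : Prop :=
  forall u : nat -> T,
    (forall e : R, 0 < e -> exists N : nat, forall m n : nat,
        (N <= m)%N -> (N <= n)%N -> d (u m) (u n) < e) ->
    exists l : T, u @ \oo --> l.

Definition separable (T : topologicalType) : Prop :=
  exists2 D : set T, countable D & dense D.

Definition polish (T : topologicalType) : Prop :=
  separable T /\
  exists d : T -> T -> R,
    [/\ is_metric d, metric_compatible d & metric_complete d].

(* [zero_dimensional] of MathComp-Analysis only asks that clopen sets separate
   points, which is strictly weaker for non-compact Polish spaces; what is
   needed here is a basis of clopen sets. *)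
Definition clopen_basis (T : topologicalType) : Prop :=
  basis [set U : set T | clopen U].

(* The space Y may be empty, so that the empty set is analytic. *)
Definition Sigma11 (T : topologicalType) (A : set T) : Prop :=
  exists Y : topologicalType, polish Y /\
  exists2 f : Y -> T, continuous f & A = range f.

Definition Pi11 (T : topologicalType) (A : set T) : Prop := Sigma11 (~` A).

Definition baire_space : topologicalType := {ptws nat -> nat}.

Definition Sigma12 (T : topologicalType) (A : set T) : Prop :=
  exists2 B : set (T * baire_space)%type, Pi11 B & A = fst @` B.

Definition complete_for (Gamma : forall T : topologicalType, set T -> Prop)
    (X : topologicalType) (C : set X) : Prop :=
  Gamma X C /\
  forall Z : topologicalType, polish Z -> clopen_basis Z ->
  forall D : set Z, Gamma Z D ->
  exists2 g : Z -> X, continuous g & D = g @^-1` C.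

End descriptive_set_theory.

Section martingales.
Variable R : realType.

(* [0,1]^(2^<omega) is viewed inside R^(2^<omega): both induce the same
   topology on the set of martingales. *)
Definition martingale : set {ptws seq bool -> R} :=
  [set f | (forall s, 0 <= f s <= 1) /\
           (forall s, f s = (f (rcons s false) + f (rcons s true)) / 2)].

Definition martingale_space : topologicalType := set_type martingale.

Definition martingale_seq_space : topologicalType :=
  {ptws nat -> martingale_space}.

(* [mkseq beta l] is the initial segment beta|l. *)
Definition along (f : martingale_space) (beta : cantor_space) : nat -> R :=
  fun l => set_val f (mkseq beta l).

Definition everywhere_converging : set martingale_space :=
  [set f | forall beta : cantor_space, cvgn (along f beta)].

Definition psi (f : martingale_space) (beta : cantor_space) : R :=
  limn (along f beta).

Definition seq_psi_cvg : set martingale_seq_space :=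
  [set f | (forall k, everywhere_converging (f k)) /\
           forall beta, cvgn (fun k => psi (f k) beta)].

Definition seq_psi_cvg0 : set martingale_seq_space :=
  [set f | (forall k, everywhere_converging (f k)) /\
           forall beta, (fun k => psi (f k) beta) @ \oo --> (0 : R)].

Definition seq_psi_subseq_cvg0 : set martingale_seq_space :=
  [set f | (forall k, everywhere_converging (f k)) /\
           exists2 i : nat -> nat, {homo i : m n / (m < n)%N} &
             forall beta, (fun j => psi (f (i j)) beta) @ \oo --> (0 : R)].

End martingales.

(* Main.v *)
Require Import Defs.
From mathcomp Require Import all_boot all_order all_algebra.
From mathcomp Require Import all_classical all_reals all_analysis.
From mathcomp Require Import lra zify.

Set Implicit Arguments.
Unset Strict Implicit.
Unset Printing Implicit Defensive.

Import Order.TTheory GRing.Theory Num.Theory.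
Import numFieldNormedType.Exports.

Local Open Scope classical_set_scope.
Local Open Scope ring_scope.

(** Upper bounds.  A sequence [f] fails to lie in the set of (a) or (b) iff
    some [beta] in Cantor space either makes some [f_k] diverge along [beta] or
    makes [psi (f_k) beta] fail to converge (to 0).  Both failures are of the
    form "exists j, forall N, exists m, forall l, closed condition on finitely
    many values of [f]", so after introducing Skolem functions the complement
    becomes the projection of a closed subset of a Polish space.  For (c) the
    same is done with the subsequence as an additional parameter.

    Hardness.  Let [A], the range of a continuous [f] on a Polish space with
    dense sequence [q], be the complement of the given coanalytic set.  A point
    of Cantor space codes a set of requests "use the approximation [q_p] at
    time [n]"; the test at time [n] asks that some request be consistent with
    all earlier ones and that [f] take, near [q_p], a value in the [n]-th
    clopen neighbourhood [C n] of [x].  Then [x] is in [A] iff some [beta]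
    passes the tests infinitely often, and for this the times can be restricted
    to any prescribed infinite set.  Each test depends on finitely many values
    of [beta], so its indicator function is the limit of an eventually constant
    martingale; this gives (a) and (b).

    For (c), where membership reads "exists alpha, (x, alpha) is not in [A]",
    the martingales are indexed by the finite sequences [s], and [s] runs the
    test at time [size s] on the neighbourhoods determined by [s].  In addition
    the martingale at [s] tests whether [s] is a minimal element of the set of
    sequences coded by [beta].  A subsequence tending to 0 then corresponds to
    a set of finite sequences all of whose subsets have finitely many minimal
    elements; such a set contains infinitely many initial segments of a single
    [alpha]. *)

(** * Polish spaces *)

Lemma cvg_ptws (I : Type) (T : topologicalType) (F : set_system (I -> T))
  (f : {ptws I -> T}) : Filter F ->
  F --> f <-> forall i, (fun g : I -> T => g i) @ F --> f i.
Proof.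
move=> FF; split=> [Ff i|Ff].
  move/cvg_sup : Ff => /(_ i) Ff A nA; apply: Ff.
  exact: (@initial_continuous _ _ (fun g : {classic I -> T} => g i) f).
apply/cvg_sup => i A [_ [[B oB <-] Bfi]] BA.
apply: filterS BA _; apply: (Ff i); exact: open_nbhs_nbhs.
Qed.

Lemma continuous_ptws (S : topologicalType) (I : Type) (T : topologicalType)
  (g : S -> {ptws I -> T}) :
  (forall i, continuous (fun s => g s i)) -> continuous g.
Proof. by move=> gc s; apply/cvg_ptws => i; exact: gc. Qed.

Lemma continuous_eval (I : Type) (T : topologicalType) i :
  continuous (fun f : {ptws I -> T} => (f : I -> T) i).
Proof.
move=> f A nA; have /cvg_ptws/(_ i) fi : nbhs f --> f by [].
exact: (fi (nbhs_filter f) _ nA).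
Qed.

Lemma set_val_continuous (T : topologicalType) (A : set T) :
  continuous (set_val : set_type A -> T).
Proof. exact: initial_continuous. Qed.

Section approximation_radius.
Variable R : realType.

Definition eps (n : nat) : R := n.+1%:R^-1.

Lemma eps_gt0 n : 0 < eps n.
Proof. by rewrite invr_gt0 ltr0n. Qed.

Lemma eps_le m n : (m <= n)%N -> eps n <= eps m.
Proof. by move=> mn; rewrite lef_pV2 ?posrE ?ltr0n// ler_nat. Qed.

Lemma eps_le1 n : eps n <= 1.
Proof. by rewrite -[leRHS]invr1; exact: (@eps_le 0 n). Qed.

Lemma eps_lt (e : R) : 0 < e -> exists N, forall n, (N <= n)%N -> eps n < e.
Proof.
move=> e0; exists (Num.truncn e^-1) => n /eps_le /le_lt_trans; apply.
by rewrite invf_plt ?posrE ?ltr0n//; exact: truncnS_gt.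
Qed.

End approximation_radius.
Arguments eps {R}.
Arguments eps_gt0 {R}.

Section polish_spaces.
Variable R : realType.

(** The enumeration is partial so that the empty space is covered; its index type is free so that
    each construction can use a natural one. *)
Definition polish_by (T : topologicalType) (d : T -> T -> R) (J : countType)
    (e : J -> option T) : Prop :=
  [/\ is_metric d, metric_compatible d, metric_complete d &
      forall x r, 0 < r -> exists j y, e j = Some y /\ d x y < r].

Lemma metric_nbhs (T : topologicalType) (d : T -> T -> R) x r :
  metric_compatible d -> 0 < r -> nbhs x [set y | d x y < r].
Proof. by move=> dc r0; apply/dc; exists r. Qed.

Lemma metricxx (T : topologicalType) (d : T -> T -> R) x :
  is_metric d -> d x x = 0.
Proof. by case=> _ d0 _ _; apply/d0. Qed.

Lemma polishP (T : topologicalType) :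
  polish R T <->
  exists d, exists J : countType, exists e : J -> option T, polish_by d e.
Proof.
split=> [[[D /countable_injP[f finj] Dd] [d [dm dc dcpl]]]|
         [d [J [e [dm dc dcpl de]]]]].
  pose e n := xget None [set o | exists y, [/\ o = Some y, D y & f y = n]].
  exists d, nat, e; split=> // x r r0.
  have := metric_nbhs x dc r0; rewrite nbhsE; move=> [V [oV Vx] Vr].
  have [y [/Vr yr Dy]] := Dd _ (ex_intro _ x Vx) oV.
  exists (f y), y; split=> //.
  rewrite /e; case: xgetP => [? -> [z [-> Dz fz]]|/(_ (Some y))]; last first.
    by case; exists y.
  by congr Some; apply: finj; rewrite ?inE.
split; last by exists d.
exists [set y | exists j, e j = Some y].
  apply/countable_injP.
  pose f y := xget None [set o | exists j, o = Some j /\ e j = Some y].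
  have fP y : (exists j, e j = Some y) -> exists j, f y = Some j /\ e j = Some y.
    move=> [j ej]; rewrite /f; case: xgetP => [? -> [i [-> ei]]|/(_ (Some j))].
      by exists i.
    by case; exists j.
  exists (pickle \o f) => x y /set_mem/fP[i [fx ei]] /set_mem/fP[j [fy ej]] /=.
  by move=> /(pcan_inj pickleK); rewrite fx fy => -[ij]; move: ei; rewrite ij ej; case.
move=> O [x Ox] oO; have /dc[r r0 rO] : nbhs x O by exact: open_nbhs_nbhs.
have [j [y [ej dxy]]] := de x _ r0.
by exists y; split; [exact: rO|exists j].
Qed.

Lemma metric_hausdorff_space (T : topologicalType) (d : T -> T -> R) :
  is_metric d -> metric_compatible d -> hausdorff_space T.
Proof.
move=> [d0 deq dsym dtri] dc x y xy; apply/deq/eqP; rewrite eq_le d0 andbT.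
apply/ler_addgt0Pl => r r0; rewrite addr0.
have r2 : 0 < r / 2 by rewrite divr_gt0.
have [z [/= xz yz]] := xy _ _ (metric_nbhs x dc r2) (metric_nbhs y dc r2).
apply: (le_trans (dtri x z y)); rewrite (splitr r) (dsym z y).
by rewrite lerD// ltW.
Qed.

Lemma polish_hausdorff (T : topologicalType) : polish R T -> hausdorff_space T.
Proof. by move=> /polishP[d [J [e [dm dc _ _]]]]; exact: metric_hausdorff_space dm dc. Qed.

Lemma metric_cvgP (T : topologicalType) (d : T -> T -> R) (u : nat -> T) l :
  metric_compatible d ->
  u @ \oo --> l <->
  forall r, 0 < r -> exists N, forall n, (N <= n)%N -> d l (u n) < r.
Proof.
move=> dc; split=> [ul r r0|ul A /dc[r /ul[N Nr] rA]].
  by have [N _ NP] := ul _ (metric_nbhs l dc r0); exists N => n /NP.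
by exists N => // n /= /Nr /rA.
Qed.

Lemma polish_prod (T U : topologicalType) :
  polish R T -> polish R U -> polish R (T * U)%type.
Proof.
move=> /polishP[d [I [e [[d0 deq dsym dtri] dc dcpl de]]]].
move=> /polishP[d' [J [e' [[d'0 d'eq d'sym d'tri] dc' dcpl' de']]]].
apply/polishP.
exists (fun x y => Num.max (d x.1 y.1) (d' x.2 y.2)), (I * J)%type.
exists (fun ij => if e ij.1 is Some x then
                    if e' ij.2 is Some y then Some (x, y) else None else None).
have cc : metric_compatible (fun x y : T * U => Num.max (d x.1 y.1) (d' x.2 y.2)).
  move=> [x y] A; split=> [[[P Q] /= [/dc[r r0 rP] /dc'[s s0 sQ]] PQA]|[r r0 rA]].
    exists (Num.min r s); first by rewrite lt_min r0.
    move=> [x' y'] /=; rewrite gt_max !lt_min => /andP[/andP[rx _] /andP[_ sy]].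
    by apply: PQA; split; [exact: rP|exact: sQ].
  exists ([set x' | d x x' < r], [set y' | d' y y' < r]).
    by split; exact: metric_nbhs.
  by move=> [x' y'] [/= dx dy]; apply: rA; rewrite /= gt_max dx dy.
split=> //.
- split=> [x y|[x x'] [y y']|x y|x y z].
  + by rewrite le_max d0.
  + split=> /= [mxy|[-> ->]].
      have [dx0 dy0] : d x y = 0 /\ d' x' y' = 0.
        split; apply/eqP; rewrite eq_le ?d0 ?d'0 andbT -mxy.
          by rewrite le_max lexx.
        by rewrite le_max lexx orbT.
      by congr pair; [exact/deq|exact/d'eq].
    by rewrite (deq _ _).2// (d'eq _ _).2// maxxx.
  + by rewrite dsym d'sym.
  + rewrite ge_max; apply/andP; split.
      by apply: (le_trans (dtri _ y.1 _)); rewrite lerD// le_max lexx.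
    by apply: (le_trans (d'tri _ y.2 _)); rewrite lerD// le_max lexx orbT.
- move=> u uc.
  have [|l ul] := dcpl (fst \o u).
    move=> r /uc[N NP]; exists N => m n Nm Nn.
    by have := NP _ _ Nm Nn; rewrite gt_max => /andP[].
  have [|l' ul'] := dcpl' (snd \o u).
    move=> r /uc[N NP]; exists N => m n Nm Nn.
    by have := NP _ _ Nm Nn; rewrite gt_max => /andP[].
  exists (l, l'); apply/(metric_cvgP _ _ cc) => r r0.
  move/(metric_cvgP _ _ dc): ul => /(_ _ r0)[N NP].
  move/(metric_cvgP _ _ dc'): ul' => /(_ _ r0)[M MP].
  exists (maxn N M) => n; rewrite geq_max => /andP[Nn Mn].
  by rewrite gt_max NP//= MP.
- move=> [x y] r r0.
  have [i [x' [ex dx]]] := de x _ r0; have [j [y' [ey dy]]] := de' y _ r0.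
  by exists (i, j), (x', y'); rewrite /= ex ey gt_max dx dy.
Qed.

Lemma polish_closed (T : topologicalType) (A : set T) :
  polish R T -> closed A -> polish R (set_type A).
Proof.
move=> /polishP[d [J [e [[d0 deq dsym dtri] dc dcpl de]]]] cA; apply/polishP.
pose d' (x y : set_type A) := d (set_val x) (set_val y).
(* The dense points of [T] may all miss [A], so for each [j] and [m] a point of [A] within [eps m]
   of the [j]-th one is picked whenever there is one. *)
pose near_pts j m := [set o | exists a : set_type A,
  o = Some a /\ exists y, e j = Some y /\ d (set_val a) y < eps m].
exists d', (J * nat)%type, (fun jm => xget None (near_pts jm.1 jm.2)).
have cc : metric_compatible d'.
  move=> x B; split=> [[_ [[C oC <-] Cx] CB]|[r r0 rB]].
    have /dc[r r0 rC] : nbhs (set_val x) C by exact: open_nbhs_nbhs.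
    by exists r => // y ry; apply: CB; exact: rC.
  apply: filterS rB _; exact: (@set_val_continuous _ A x _ (metric_nbhs (set_val x) dc r0)).
split=> //.
- split=> [x y|x y|x y|x y z]; [exact: d0| |exact: dsym|exact: dtri].
  by split=> [/deq/val_inj//|->]; apply/deq.
- move=> u uc; have [|l ul] := dcpl (fun n => set_val (u n)); first exact: uc.
  have Al : A l.
    apply: (@closed_cvg _ _ _ _ (fun n => set_val (u n)) A cA _ _ ul).
    by apply: nearW => n; exact: set_valP.
  exists (exist _ l (mem_set Al)); apply/(metric_cvgP _ _ cc) => r r0.
  by move/(metric_cvgP _ _ dc): ul => /(_ _ r0).
- move=> x r r0; have r2 : 0 < r / 2 by rewrite divr_gt0.
  have [m mr] := eps_lt r2.
  have [j [y [ej dxy]]] := de (set_val x) _ (@eps_gt0 R m).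
  have : exists o, near_pts j m o by exists (Some x), x; split=> //; exists y.
  move=> /(xgetPex None)[a [ea [y' [ej' day]]]].
  exists (j, m), a; split=> //=; move: ej'; rewrite ej => -[yy].
  apply: (le_lt_trans (dtri _ y _)); rewrite (splitr r) ltrD//.
    exact: lt_trans dxy (mr _ _).
  by rewrite dsym yy (lt_trans day)// mr.
Qed.

End polish_spaces.

Lemma near_all_lt (T : Type) (F : set_system T) (P : nat -> T -> Prop) :
  Filter F -> (forall i, \forall x \near F, P i x) ->
  forall b, \forall x \near F, forall i, (i < b)%N -> P i x.
Proof.
move=> FF FP; elim=> [|b IH]; first exact: nearW.
apply: filterS2 IH (FP b) => x IH Pb i; rewrite ltnS leq_eqVlt.
by move=> /predU1P[->|/IH].
Qed.

(** * Countable products, the real line and Baire space *)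

Section polish_products.
Variable R : realType.

Section product_metric.
Variables (I : countType) (T : Type) (d : T -> T -> R).
Hypothesis dm : is_metric d.

(** Truncation at [eps (pickle i)] leaves only finitely many coordinates visible at each positive
    scale, which is what yields the product topology. *)
Definition product_metric (x y : I -> T) : R :=
  sup [set r | exists i, r = Num.min (d (x i) (y i)) (eps (pickle i))].

Lemma product_metric_ge (x y : I -> T) i :
  Num.min (d (x i) (y i)) (eps (pickle i)) <= product_metric x y.
Proof.
apply: ub_le_sup; last by exists i.
by exists 1 => _ [j ->]; rewrite ge_min eps_le1 orbT.
Qed.

Lemma product_metric_le (x y : I -> T) r : 0 <= r ->
  (forall i, r < eps (pickle i) -> d (x i) (y i) <= r) ->
  product_metric x y <= r.
Proof.
move=> r0 xyr; rewrite /product_metric.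
have [->|/set0P E0] := eqVneq [set r | exists i, r = Num.min (d (x i) (y i)) (eps (pickle i))] set0.
  by rewrite sup0.
apply: ge_sup => // _ [i ->]; rewrite ge_min.
by have [_|/xyr ->] := leP (eps (pickle i)) r; rewrite ?orbT.
Qed.

Lemma product_metric_lt (x y : I -> T) r i :
  product_metric x y < r -> r <= eps (pickle i) -> d (x i) (y i) < r.
Proof.
move=> xyr ri; have := le_lt_trans (product_metric_ge x y i) xyr.
by rewrite gt_min => /orP[//|/(le_lt_trans ri)]; rewrite ltxx.
Qed.

Lemma product_metric_is_metric : is_metric product_metric.
Proof.
have [d0 deq dsym dtri] := dm.
have D0 (x y : I -> T) : 0 <= product_metric x y.
  have [[i _]|Ie] := pselect (exists i : I, True).
    by apply: le_trans (product_metric_ge x y i); rewrite le_min d0/= ltW ?eps_gt0.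
  rewrite /product_metric (_ : mkset _ = set0) ?sup0//.
  by rewrite -subset0 => r [i _]; apply: Ie; exists i.
split=> // [x y|x y|x y z].
- split=> [xy0|->].
    apply/funext => i; apply/deq/eqP; rewrite eq_le d0 andbT.
    have := product_metric_ge x y i; rewrite xy0 ge_min => /orP[//|].
    by rewrite leNgt eps_gt0.
  apply/eqP; rewrite eq_le D0 andbT; apply: product_metric_le => // i _.
  by rewrite (deq _ _).2.
- by rewrite /product_metric; congr sup; apply/eq_set => r; under eq_exists do rewrite dsym.
- rewrite {1}/product_metric.
  have [->|/set0P E0] := eqVneq [set r | exists i, r = Num.min (d (x i) (z i)) (eps (pickle i))] set0.
    by rewrite sup0 addr_ge0.
  apply: ge_sup => // _ [i ->].
  have := product_metric_ge x y i; have := product_metric_ge y z i.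
  have := dtri (x i) (y i) (z i); have := d0 (x i) (y i); have := d0 (y i) (z i).
  have := @eps_gt0 R (pickle i).
  case: (leP (d (x i) (z i)) (eps (pickle i))) => ?; case: (leP (d (x i) (y i)) (eps (pickle i))) => ?;
    case: (leP (d (y i) (z i)) (eps (pickle i))) => ? ? ? ? ? ? ?; lra.
Qed.

End product_metric.

Lemma polish_ptws (I : countType) (T : topologicalType) (t0 : T) :
  polish R T -> polish R {ptws I -> T}.
Proof.
move=> /polishP[d [J [e [dm dc dcpl de]]]]; apply/polishP.
exists (product_metric d), (seq (option J)).
(* The dense points prescribe finitely many coordinates through [e] and equal [t0] on the others. *)
exists (fun s => Some (fun i => odflt t0 (obind e (nth None s (pickle i))))).
have cc : metric_compatible (product_metric d : {ptws I -> T} -> {ptws I -> T} -> R).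
  move=> x A; split=> [|[r r0 rA]].
    pose F : set_system {ptws I -> T} :=
      filter_from [set r : R | 0 < r] (fun r => [set y | product_metric d x y < r]).
    suff : F --> x by move=> /[apply] -[r r0 rA]; exists r.
    have FF : Filter F.
      apply: filter_from_filter; first by exists 1; exact: ltr01.
      move=> r s r0 s0; exists (Num.min r s); first by rewrite /= lt_min r0 s0.
      by move=> y /=; rewrite lt_min => /andP.
    apply/cvg_ptws => i B /dc[r r0 rB].
    exists (Num.min r (eps (pickle i))); first by rewrite /= lt_min r0 eps_gt0.
    move=> y /= xy; apply: rB; apply: lt_le_trans (_ : Num.min r (eps (pickle i)) <= r).
      by apply: product_metric_lt xy _; rewrite ge_min lexx orbT.
    by rewrite ge_min lexx.
  have r2 : 0 < r / 2 by rewrite divr_gt0.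
  have [N NP] := eps_lt r2.
  suff : nbhs x [set y | forall n, (n < N)%N -> forall i, pickle i = n -> d (x i) (y i) < r / 2].
    apply: filterS => y xy; apply: rA => /=; apply: (@le_lt_trans _ _ (r / 2)); last lra.
    apply: product_metric_le => [|i ri]; first exact: ltW.
    apply/ltW/(xy (pickle i)) => //; rewrite ltnNge; apply/negP => /NP.
    by move=> /(lt_trans ri); rewrite ltxx.
  apply: (@near_all_lt _ (nbhs x)
    (fun n y => forall i, pickle i = n -> d (x i) (y i) < r / 2)) => n.
  have [[i <-]|ni] := pselect (exists i : I, pickle i = n); last first.
    by apply: nearW => y i iN; exfalso; apply: ni; exists i.
  have /cvg_ptws/(_ i) xi : nbhs x --> x by [].
  have xir : nbhs x [set y | d (x i) (y i) < r / 2].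
    exact: xi (metric_nbhs (x i) dc r2).
  by apply: filterS xir => y xy j /(pcan_inj pickleK) ->.
split=> //.
- exact: product_metric_is_metric.
- move=> u uc.
  have uci i : exists l : T, (fun n => u n i) @ \oo --> l.
    apply: (dcpl (fun n => u n i)) => r r0.
    have [|N NP] := uc (Num.min r (eps (pickle i))); first by rewrite lt_min r0 eps_gt0.
    exists N => m n Nm Nn; apply: lt_le_trans (_ : Num.min r (eps (pickle i)) <= r).
      by apply: product_metric_lt (NP _ _ Nm Nn) _; rewrite ge_min lexx orbT.
    by rewrite ge_min lexx.
  have [l ul] := choice uci.
  by exists l; apply/cvg_ptws.
- move=> x r r0; have r2 : 0 < r / 2 by rewrite divr_gt0.
  have [j jP] := choice (fun i => de (x i) _ r2).
  have [N NP] := eps_lt r2.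
  eexists (mkseq (fun n => omap j (unpickle n)) N), _; split; first by [].
  apply: (@le_lt_trans _ _ (r / 2)); last lra.
  apply: product_metric_le => [|i ri]; first exact: ltW.
  rewrite nth_mkseq ?pickleK/=; last first.
    by rewrite ltnNge; apply/negP => /NP /(lt_trans ri); rewrite ltxx.
  by have [y [-> /ltW]] := jP i.
Qed.

Lemma polish_real : polish R R.
Proof.
apply/polishP; exists (fun x y => `|x - y|), rat, (fun q => Some (ratr q)).
have cc : metric_compatible (fun x y : R => `|x - y|).
  by move=> x A; split=> [/nbhs_ballP[r r0 rA]|[r r0 rA]]; [exists r|apply/nbhs_ballP; exists r].
split=> //.
- split=> [x y|x y|x y|x y z]; first exact: normr_ge0.
  + by split=> [/eqP|->]; [rewrite normr_eq0 subr_eq0 => /eqP|rewrite subrr normr0].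
  + exact: distrC.
  + exact: ler_distD.
- move=> u uc; suff : cvgn u by move=> ul; exists (limn u).
  apply/cauchy_cvgP/cauchy_exP => r r0; have [N NP] := uc _ r0.
  by exists (u N), N => // n /= Nn; exact: NP.
- move=> x r r0; have /rat_in_itvoo[q] : x - r < x + r by lra.
  rewrite in_itv/= => /andP[qx xq]; exists q, (ratr q); split => //.
  by rewrite ltr_norml; apply/andP; split; lra.
Qed.

Lemma polish_nat : polish R nat.
Proof.
apply/polishP; exists (fun m n => (m != n)%:R), nat, Some.
have lt1 (m n : nat) : ((m != n)%:R < 1 :> R) -> m = n.
  by case: (eqVneq m n) => // _; rewrite ltxx.
split.
- split=> [x y|x y|x y|x y z]; first exact: ler0n.
  + by case: (eqVneq x y) => [->|/eqP xy]; split=> // /eqP; rewrite oner_eq0.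
  + by rewrite eq_sym.
  + have [<-|_] := eqVneq x y; first by rewrite add0r.
    by rewrite (@le_trans _ _ 1) ?lerDl// lern1 leq_b1.
- move=> x A; split=> [/nbhs_singleton Ax|[r r0 rA]].
    by exists 1 => // y /lt1 <-.
  by rewrite nbhs_principalE; apply/principal_filterP; apply: rA; rewrite /= eqxx.
- move=> u /(_ _ ltr01)[N NP]; exists (u N) => A /nbhs_singleton Au.
  by exists N => // n /= Nn; rewrite -(lt1 (u N) (u n))//; exact: NP.
- by move=> x r r0; exists x, x; rewrite eqxx.
Qed.

Lemma polish_baire : polish R baire_space.
Proof. exact: polish_ptws 0%N polish_nat. Qed.

End polish_products.

(** * Upper bounds *)

Section convergence_criteria.
Variable R : realType.
Implicit Types a : nat -> R.

Lemma eps_ltS j : eps j.+1 < eps j :> R.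
Proof. by rewrite ltf_pV2 ?posrE ?ltr0n// ltr_nat. Qed.

Lemma ncvg0P a (l : R) : ~ (a @ \oo --> l) <->
  exists j, forall N, exists2 n, (N <= n)%N & eps j <= `|a n - l|.
Proof.
split=> [al|[j aj] al]; last first.
  have /cvgrPdist_lt/(_ _ (eps_gt0 j))[N _ NP] := al.
  by have [n /NP] := aj N; rewrite /= distrC ltNge => /negP.
apply: contrapT => /forallNP aj; apply: al; apply/cvgrPdist_lt => r r0.
have [j jr] := eps_lt r0; have /existsNP[N NP] := aj j.
exists N => // n /= Nn; apply: lt_trans (jr _ (leqnn j)); rewrite distrC ltNge.
by apply/negP => jn; apply: NP; exists n.
Qed.

(** This negates the Cauchy criterion with one of the two indices fixed to be [N], so that a single
    Skolem function for [n] witnesses divergence. *)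
Lemma ncvgP a : ~ cvgn a <->
  exists j, forall N, exists2 n, (N <= n)%N & eps j <= `|a n - a N|.
Proof.
split=> [al|[j aj] al].
  apply: contrapT => /forallNP aj; apply: al.
  apply/cauchy_cvgP/cauchy_exP => r r0.
  have [j jr] := eps_lt r0; have /existsNP[N NP] := aj j.
  exists (a N), N => // n /= Nn; rewrite /ball/= distrC.
  apply: lt_trans (jr _ (leqnn j)); rewrite ltNge.
  by apply/negP => jn; apply: NP; exists n.
have j2 : 0 < eps j / 2 :> R by rewrite divr_gt0// eps_gt0.
have /cvgrPdist_lt/(_ _ j2)[N _ NP] : a @ \oo --> limn a by [].
have [n Nn] := aj N; rewrite leNgt => /negP; apply.
have -> : a n - a N = (limn a - a N) - (limn a - a n) by lra.
by rewrite (le_lt_trans (ler_normB _ _))// (splitr (eps j)) ltrD// NP//=.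
Qed.

(** Bounds on the limits are traded for closed conditions on finite stages. Lowering the threshold
    from [eps j] to [eps j.+1] leaves room for convergence; conversely, a bound on all late stages
    passes to the limit. *)
Lemma eventually_geP (q : nat -> nat -> R) (v : nat -> nat -> nat -> R) :
  (forall N n, v N n @ \oo --> q N n) ->
  (exists j, forall N, exists2 n, (N <= n)%N & eps j <= q N n) <->
  (exists j, forall N, exists2 n, (N <= n)%N &
     exists L, forall l, (L <= l)%N -> eps j <= v N n l).
Proof.
move=> vq; split=> -[j jP].
  exists j.+1 => N; have [n Nn jq] := jP N; exists n => //.
  have r0 : 0 < q N n - eps j.+1 by rewrite subr_gt0 (lt_le_trans (eps_ltS j)).
  have /cvgrPdist_lt/(_ _ r0)[L _ LP] := vq N n.
  exists L => l /LP /=; rewrite ltr_norml => /andP[_]; lra.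
exists j => N; have [n Nn [L LP]] := jP N; exists n => //.
rewrite -(cvg_lim (@Rhausdorff R) (vq N n)); apply: limr_ge.
  by apply/cvg_ex; exists (q N n).
by exists L.
Qed.

End convergence_criteria.

(** * Projections of closed sets along Baire space *)

Section upper_bounds.
Variable R : realType.

Lemma near_baire (w : baire_space) i :
  \forall w' \near w, (w' : nat -> nat) i = w i.
Proof.
have /cvg_ptws/(_ i) wi : nbhs w --> w by [].
exact: (wi _ (discrete_set1 (w i : nat))).
Qed.

Section projections.
Variable X : topologicalType.
Hypothesis X_polish : polish R X.

Lemma Sigma11_proj (F : set (X * baire_space)) :
  closed F -> Sigma11 R (fst @` F).
Proof.
move=> cF; exists (set_type F); split.
  exact: polish_closed (polish_prod X_polish (polish_baire R)) cF.
exists (fun y => (set_val y).1).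
  move=> y; apply: (@continuous_comp _ _ _ (@set_val _ F) fst).
    exact: set_val_continuous.
  exact: cvg_fst.
apply/seteqP; split=> [_ [y Fy <-]|_ [y _ <-]].
  by exists (exist _ y (mem_set Fy)).
by exists (set_val y) => //; exact: set_valP.
Qed.

(** Near [w] the section is constant, so a point [(x, w)] of the closure has [x] in the closure of
    [P w]. *)
Lemma closed_locally_constant (P : baire_space -> set X) :
  (forall w, closed (P w)) -> (forall w, \forall w' \near w, P w' = P w) ->
  closed [set xw : X * baire_space | P xw.2 xw.1].
Proof.
move=> cP locP [x w] xw; apply: (cP w) => B Bx.
have [|[x' w'] [/= Pw' [Bx' Pw]]] := xw (B `*` [set w' | P w' = P w]).
  by exists (B, [set w' | P w' = P w]) => //; split=> //; exact: locP.
by exists x'; split=> //; rewrite -Pw.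
Qed.

Variables (u : nat -> seq bool -> X -> R) (v : nat -> nat -> seq bool -> X -> R).
Hypothesis u_cont : forall k s, continuous (u k s).
Hypothesis v_cont : forall N n s, continuous (v N n s).

Definition diverging_branch : set X :=
  [set x | exists beta : nat -> bool,
     (exists k, ~ cvgn (fun l => u k (mkseq beta l) x)) \/
     (exists j, forall N, exists2 n, (N <= n)%N &
        exists L, forall l, (L <= l)%N -> eps j <= v N n (mkseq beta l) x)].

(* A point [w] of Baire space is split into rows: row 0 holds the case, [k] and
   [j]; row 1 the branch [beta]; rows 2 and 3 the Skolem functions for [n - N]
   and [L]. *)
Let part (w : nat -> nat) (c n : nat) := w (pickle (c, n)).
Let branch (w : nat -> nat) n := odd (part w 1 n).

(** [w] witnesses that [x] lies in [diverging_branch] when this closed condition holds for all [N]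
    and [l]; for fixed [N] and [l] it reads only finitely many entries of [w]. *)
Let P (w : baire_space) N l : set X := [set x |
  let m := (N + part w 2 N)%N in
  if part w 0 0 == 0%N then
    (eps (part w 0 2) <= `|u (part w 0 1) (mkseq (branch w) m) x -
                           u (part w 0 1) (mkseq (branch w) N) x| : Prop)
  else (part w 3 N <= l)%N -> eps (part w 0 2) <= v N m (mkseq (branch w) l) x].

Let P_closed w N l : closed (P w N l).
Proof.
rewrite /P/=; case: (part w 0 0 == 0%N).
  set s := mkseq _ _; set t := mkseq _ _; set k := part w 0 1.
  apply: (@preimage_closed _ _ (fun x => `|u k s x - u k t x|)
    [set r | eps (part w 0 2) <= r]); last exact: closed_ge.
  by move=> x _; apply: cvg_norm; apply: cvgB; exact: u_cont.
case: (part w 3 N <= l)%N; last first.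
  by rewrite (_ : mkset _ = setT); [exact: closedT|apply/seteqP; split].
rewrite (_ : mkset _ =
    v N (N + part w 2 N)%N (mkseq (branch w) l) @^-1` [set r | eps (part w 0 2) <= r]).
  apply: preimage_closed; last exact: closed_ge.
  by move=> x _; exact: v_cont.
by apply/seteqP; split=> x /=; [apply|].
Qed.

Let P_loc w N l : \forall w' \near w, P w' N l = P w N l.
Proof.
have wp c n : \forall w' \near w, part w' c n = part w c n by exact: near_baire.
have wb m : \forall w' \near w, mkseq (branch w') m = mkseq (branch w) m.
  have : \forall w' \near w, forall i, (i < m)%N -> part w' 1 i = part w 1 i.
    apply: (@near_all_lt _ (nbhs w) (fun i w' => part w' 1 i = part w 1 i)) => i.
    exact: wp.
  apply: filterS => w' ww; apply: (@eq_from_nth _ false); rewrite !size_mkseq// => i im.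
  by rewrite !nth_mkseq// /branch ww.
near=> w'; rewrite /P.
have -> : part w' 0 0 = part w 0 0 by near: w'; exact: wp.
have -> : part w' 0 1 = part w 0 1 by near: w'; exact: wp.
have -> : part w' 0 2 = part w 0 2 by near: w'; exact: wp.
have -> : part w' 2 N = part w 2 N by near: w'; exact: wp.
have -> : part w' 3 N = part w 3 N by near: w'; exact: wp.
have -> : mkseq (branch w') (N + part w 2 N) = mkseq (branch w) (N + part w 2 N).
  by near: w'; exact: wb.
have -> : mkseq (branch w') N = mkseq (branch w) N by near: w'; exact: wb.
have -> : mkseq (branch w') l = mkseq (branch w) l by near: w'; exact: wb.
by [].
Unshelve. all: by end_near. Qed.

Let assemble (F : nat -> nat -> nat) (p : nat) : nat :=
  if unpickle p is Some (c, n) then F c n else 0%N.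

Let part_assemble F c n : part (assemble F) c n = F c n.
Proof. by rewrite /part /assemble pickleK. Qed.

Lemma Sigma11_diverging_branch : Sigma11 R diverging_branch.
Proof.
pose F := \bigcap_(N in [set: nat]) \bigcap_(l in [set: nat])
  [set xw : X * baire_space | P xw.2 N l xw.1].
suff -> : diverging_branch = fst @` F.
  apply: Sigma11_proj; apply: closed_bigI => N _; apply: closed_bigI => l _.
  by apply: (@closed_locally_constant (fun w => P w N l)) => w; [exact: P_closed|exact: P_loc].
apply/seteqP; split=> [x [beta [[k /ncvgP[j jP]]|[j jP]]]|_ [[x w] Fxw <-]].
- have gex N : exists g,
      eps j <= `|u k (mkseq beta (N + g)) x - u k (mkseq beta N) x|.
    by have [n Nn jn] := jP N; exists (n - N)%N; rewrite subnKC.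
  have [g gP] := choice gex.
  pose w := assemble (fun c n => match c with
    | 0 => nth 0 [:: 0; k; j] n | 1 => beta n | _ => g n end)%N.
  exists (x, w) => // N _ l _; rewrite /P/= !part_assemble/=.
  by rewrite (_ : branch w = beta)//; apply/funext => n; rewrite /branch part_assemble oddb.
- have gex N : exists g : nat * nat, forall l, (g.2 <= l)%N ->
      eps j <= v N (N + g.1) (mkseq beta l) x.
    have [n Nn [L LP]] := jP N.
    by exists (n - N, L)%N => /= l; rewrite subnKC//; exact: LP.
  have [g gP] := choice gex.
  pose w := assemble (fun c n => match c with
    | 0 => nth 0 [:: 1; 0; j] n | 1 => beta n | 2 => (g n).1 | _ => (g n).2 end)%N.
  exists (x, w) => // N _ l _; rewrite /P/= !part_assemble/=.
  rewrite (_ : branch w = beta); first exact: gP.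
  by apply/funext => n; rewrite /branch part_assemble oddb.
- exists (branch w); rewrite /=.
  have [w0|w0] := eqVneq (part w 0 0) 0%N; [left|right].
    exists (part w 0 1); apply/ncvgP; exists (part w 0 2) => N.
    have := Fxw N I 0%N I; rewrite /P/= w0/= => uN.
    by exists (N + part w 2 N)%N => //; exact: leq_addr.
  exists (part w 0 2) => N; exists (N + part w 2 N)%N; first exact: leq_addr.
  by exists (part w 3 N) => l; have := Fxw N I l I; rewrite /P/= (negbTE w0); exact.
Qed.

End projections.

Lemma closed_martingale : closed (@martingale R).
Proof.
pose ev s (f : {ptws seq bool -> R}) : R := f s.
pose gap s f := ev s f - (ev (rcons s false) f + ev (rcons s true) f) / 2.
have ev_cont s : continuous (ev s) by exact: continuous_eval.
have gap_cont s : continuous (gap s).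
  move=> f; apply: (cvgB (ev_cont s f)).
  exact: (cvgM (cvgD (ev_cont _ f) (ev_cont _ f)) (cvg_cst _)).
pose A := \bigcap_(s in setT) (ev s @^-1` [set r | 0 <= r <= 1]).
pose B := \bigcap_(s in setT) (gap s @^-1` [set 0]).
have -> : @martingale R = A `&` B.
  apply/seteqP; split=> [f [f01 fm]|f [f01 fm]]; split.
  - by move=> s _; exact: f01.
  - by move=> s _; rewrite /preimage/= /gap /ev -fm subrr.
  - by move=> s; exact: f01.
  - by move=> s; apply/eqP; rewrite -subr_eq0; apply/eqP; exact: fm.
apply: closedI; apply: closed_bigI => s _; apply: preimage_closed.
- by move=> f _; exact: ev_cont.
- have -> : [set r : R | 0 <= r <= 1] = [set` `[0, 1]%R].
    by apply/seteqP; split=> r /=; rewrite in_itv.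
  exact: interval_closed.
- by move=> f _; exact: gap_cont.
- exact: closed_eq.
Qed.

Definition zero_martingale : martingale_space R.
Proof.
exists (fun=> 0); apply/mem_set; split=> s; first by rewrite lexx ler01.
by rewrite addr0 mul0r.
Defined.

Lemma polish_martingale_seq : polish R (martingale_seq_space R).
Proof.
apply: (@polish_ptws R nat (martingale_space R) zero_martingale).
apply: polish_closed closed_martingale.
exact: (@polish_ptws R (seq bool) R 0 (polish_real R)).
Qed.

Lemma continuous_martingale_eval k s : continuous (fun f : martingale_seq_space R =>
  (set_val (f k) : {ptws seq bool -> R}) s).
Proof.
move=> f A nA; pose B := [set g : martingale_space R | A (set_val g s)].
have nB : nbhs (f k) B.
  apply: (@set_val_continuous _ (@martingale R) (f k) [set g | A (g s)]).
  exact: (@continuous_eval (seq bool) R s (set_val (f k)) A nA).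
exact: (@continuous_eval nat (martingale_space R) k f B nB).
Qed.

End upper_bounds.

(** * Upper bounds for the three sets of martingale sequences *)

Section upper_bounds_martingales.
Variable R : realType.

Lemma continuous_normr (X : topologicalType) (f : X -> R) :
  continuous f -> continuous (fun x => `|f x|).
Proof. by move=> fc x; apply: cvg_norm; exact: fc. Qed.

Lemma continuous_subr (X : topologicalType) (f g : X -> R) :
  continuous f -> continuous g -> continuous (fun x => f x - g x).
Proof. by move=> fc gc x; apply: cvgB; [exact: fc|exact: gc]. Qed.

(** [q] stands for a limit that makes sense only when every [u k] converges along every branch;
    hence divergence of [u] is a separate case, and [~ C x] is described by [q] for convergent [x]
    alone. *)
Lemma Pi11_branchwise (X : topologicalType)
    (u : nat -> seq bool -> X -> R) (v : nat -> nat -> seq bool -> X -> R)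
    (q : X -> (nat -> bool) -> nat -> nat -> R) (C : set X) :
  polish R X ->
  (forall k s, continuous (u k s)) -> (forall N n s, continuous (v N n s)) ->
  (forall x, C x -> forall beta k, cvgn (fun l => u k (mkseq beta l) x)) ->
  (forall x, (forall beta k, cvgn (fun l => u k (mkseq beta l) x)) ->
     (forall beta N n, (fun l => v N n (mkseq beta l) x) @ \oo --> q x beta N n) /\
     (~ C x <-> exists beta j, forall N, exists2 n, (N <= n)%N &
                  eps j <= q x beta N n)) ->
  Pi11 R C.
Proof.
move=> Xp uc vc Cu CP; rewrite /Pi11.
suff -> : ~` C = diverging_branch u v by exact: Sigma11_diverging_branch.
apply/seteqP; split=> x /=.
  move=> nCx; have [cvx|ncvx] := pselect (forall beta k, cvgn (fun l => u k (mkseq beta l) x)).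
    have [vq [+ _]] := CP x cvx => /(_ nCx)[beta]; rewrite (eventually_geP (vq beta)) => jP.
    by exists beta; right.
  by move/existsNP: ncvx => [beta /existsNP[k kP]]; exists beta; left; exists k.
move=> [beta +] Cx; have cvx := Cu _ Cx; have [vq [_ +]] := CP x cvx.
move=> nC [[k]|]; first by apply; exact: cvx.
by move=> vj; apply: nC Cx; exists beta; rewrite (eventually_geP (vq beta)).
Qed.

Let val_at k s (f : martingale_seq_space R) : R :=
  (set_val (f k) : {ptws seq bool -> R}) s.

Let val_at_cont k s : continuous (val_at k s).
Proof. exact: continuous_martingale_eval. Qed.

Let val_at_cvg (f : martingale_seq_space R) beta k :
  cvgn (fun l => val_at k (mkseq beta l) f) ->
  (fun l => val_at k (mkseq beta l) f) @ \oo --> psi (f k) beta.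
Proof. by []. Qed.

Lemma Pi11_seq_psi_cvg : Pi11 R (@seq_psi_cvg R).
Proof.
apply: (@Pi11_branchwise _ val_at (fun N n s f => `|val_at n s f - val_at N s f|)
  (fun f beta N n => `|psi (f n) beta - psi (f N) beta|)).
- exact: polish_martingale_seq.
- exact: val_at_cont.
- by move=> N n s; apply: continuous_normr; exact: continuous_subr.
- by move=> f [fP _] beta k; exact: fP.
- move=> f fP; split=> [beta N n|].
    by apply: cvg_norm; apply: cvgB; exact/val_at_cvg/fP.
  split=> [nCf|[beta /ncvgP nf] [_]]; last exact.
  apply: contrapT => nf; apply: nCf; split=> [k beta|beta]; first exact: fP.
  by apply: contrapT => /ncvgP nfb; apply: nf; exists beta.
Qed.

Lemma Pi11_seq_psi_cvg0 : Pi11 R (@seq_psi_cvg0 R).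
Proof.
apply: (@Pi11_branchwise _ val_at (fun N n s f => `|val_at n s f|)
  (fun f beta N n => `|psi (f n) beta|)).
- exact: polish_martingale_seq.
- exact: val_at_cont.
- by move=> N n s; apply: continuous_normr; exact: val_at_cont.
- by move=> f [fP _] beta k; exact: fP.
- move=> f fP; split=> [beta N n|].
    by apply: cvg_norm; exact/val_at_cvg/fP.
  split=> [nCf|[beta [j jP]] [_ /(_ beta)]]; last first.
    apply/ncvg0P; exists j => N; have [n Nn] := jP N.
    by exists n; rewrite ?subr0.
  apply: contrapT => nf; apply: nCf; split=> [k beta|beta]; first exact: fP.
  apply: contrapT => /ncvg0P[j jP]; apply: nf; exists beta, j => N.
  by have [n Nn] := jP N; rewrite subr0; exists n.
Qed.

Lemma continuous_locally_constant (X : topologicalType) (h : baire_space -> X -> R) :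
  (forall w, continuous (h w)) -> (forall w, \forall w' \near w, h w' = h w) ->
  continuous (fun xw : X * baire_space => h xw.2 xw.1).
Proof.
move=> hc hloc [x w] A nA.
exists (h w @^-1` A, [set w' | h w' = h w]); first by split; [exact: hc|exact: hloc].
by move=> [x' w'] [/= Ax']; rewrite /preimage/= => ->.
Qed.

Lemma Sigma12_seq_psi_subseq_cvg0 : Sigma12 R (@seq_psi_subseq_cvg0 R).
Proof.
pose inc (i : nat -> nat) n := all (fun m => i m < i m.+1)%N (iota 0 n).
(* The value 1 turns a failure of [i] to increase before stage [n] into a failure of convergence to
   0, while only finitely many entries of [i] are consulted. *)
pose h (N n : nat) (s : seq bool) (i : baire_space) (f : martingale_seq_space R) : R :=
  if inc i n then `|val_at (i n) s f| else 1.
have h_cont N n s i : continuous (h N n s i).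
  rewrite /h; case: (inc i n); last exact: cst_continuous.
  by apply: continuous_normr; exact: val_at_cont.
have h_loc N n s i : \forall i' \near i, h N n s i' = h N n s i.
  have : \forall i' \near i, forall m, (m < n.+2)%N -> (i' : nat -> nat) m = i m.
    apply: (@near_all_lt _ (nbhs i) (fun m i' => (i' : nat -> nat) m = i m)) => m.
    exact: near_baire.
  apply: filterS => i' ii; apply/funext => f; rewrite /h ii//.
  suff -> : inc i' n = inc i n by [].
  apply: eq_in_all => m; rewrite mem_iota add0n => /= mn.
  by rewrite !ii //; lia.
exists [set fi : martingale_seq_space R * baire_space |
  [/\ forall k, @everywhere_converging R (fi.1 k),
      forall m, (fi.2 m < fi.2 m.+1)%N &
      forall beta, (fun j => psi (fi.1 (fi.2 j)) beta) @ \oo --> (0 : R)]]; last first.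
  apply/seteqP; split=> [f [fP [i iinc fi0]]|_ [[f i] [/= fP iinc fi0] <-]].
    by exists (f, i) => //; split=> // m; exact: iinc.
  by split=> //; exists i => //; exact: homo_ltn ltn_trans iinc.
apply: (@Pi11_branchwise _ (fun k s fi => val_at k s fi.1)
  (fun N n s fi => h N n s fi.2 fi.1)
  (fun fi beta N n => if inc fi.2 n then `|psi (fi.1 (fi.2 n)) beta| else 1)).
- exact: polish_prod (polish_martingale_seq R) (polish_baire R).
- move=> k s fi; apply: (@continuous_comp _ _ _ fst (val_at k s)).
    exact: cvg_fst.
  exact: continuous_martingale_eval.
- by move=> N n s; exact: continuous_locally_constant.
- by move=> fi [fP _ _] beta k; exact: fP.
- move=> [f i] /= fP; split=> [beta N n|].
    rewrite /h; case: (inc i n); last exact: cvg_cst.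
    by apply: cvg_norm; exact/val_at_cvg/fP.
  split=> [nC|[beta [j jP]] [_ iinc /(_ beta)]]; last first.
    apply/ncvg0P; exists j => N; have [n Nn] := jP N.
    have -> : inc i n by apply/allP => m _; exact: iinc.
    by exists n; rewrite ?subr0.
  have [iinc|/existsNP[m im]] := pselect (forall m, (i m < i m.+1)%N).
    apply: contrapT => nf; apply: nC; split=> [k beta|//|beta /=]; first exact: fP.
    apply: contrapT => /ncvg0P[j jP]; apply: nf; exists beta, j => N.
    have [n Nn] := jP N; rewrite subr0; exists n => //.
    by have -> : inc i n by apply/allP => m _; exact: iinc.
  (* Beyond [m] the check [inc] fails, so on any branch the value is 1, which is at least
     [eps 0]. *)
  exists (fun=> false), 0%N => N; exists (maxn N m.+1); first exact: leq_maxl.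
  case: ifP => [/allP/(_ m)|_]; last exact: eps_le1.
  by rewrite mem_iota/= add0n leq_maxr => /(_ isT).
Qed.

End upper_bounds_martingales.

(** * Testing membership in an analytic set *)

Section analytic_test.
Variable R : realType.

Definition determined_by (b : nat) (t : (nat -> bool) -> bool) :=
  forall beta beta', (forall i, (i < b)%N -> beta i = beta' i) -> t beta = t beta'.

Definition shrinks_to (W : topologicalType) (C : nat -> set W) (x : W) :=
  (forall n, C n x) /\
  forall U, nbhs x U -> exists N, forall n, (N <= n)%N -> C n `<=` U.

Definition unbounded (J : set nat) := forall N, exists2 n, (N <= n)%N & J n.

Section nonempty.
Variables (W Y : topologicalType) (f : Y -> W) (d : Y -> Y -> R).
Hypothesis W_hausdorff : hausdorff_space W.
Hypothesis f_cont : continuous f.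
Hypothesis dm : is_metric d.
Hypothesis dc : metric_compatible d.
Hypothesis dcpl : metric_complete d.
Variable q : nat -> nat * Y.
Hypothesis q_dense : forall a y, exists p, (q p).1 = a /\ d y (q p).2 < eps a.

(* The bound [p <= n] makes the test at time [n] depend on finitely many values
   of [beta]; it is harmless since a request may be delayed arbitrarily. *)
Let on (beta : nat -> bool) (n p : nat) := (p <= n)%N && beta (pickle (n, p)).

(* Distinct indices force the radii along infinitely many mutually consistent
   requests to tend to 0. *)
Let consistent p p' := (q p).1 <> (q p').1 /\
  d (q p).2 (q p').2 < eps (q p).1 + eps (q p').1.

Let good (C : set W) n beta p :=
  [/\ on beta n p,
      exists y, d (q p).2 y < eps (q p).1 /\ C (f y) &
      forall n' p', (n' < n)%N -> on beta n' p' -> consistent p p'].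

Definition range_test (C : set W) n beta := `[< exists p, good C n beta p >].

Lemma range_test_determined C n :
  determined_by (\max_(i < n.+1) \max_(p < n.+1) pickle (i : nat, p : nat)).+1
    (range_test C n).
Proof.
suff imp beta beta' : (forall i, (i < (\max_(i < n.+1) \max_(p < n.+1)
      pickle (i : nat, p : nat)).+1)%N -> beta i = beta' i) ->
    range_test C n beta -> range_test C n beta'.
  move=> beta beta' bb; apply/idP/idP; apply: imp => // i ib; exact/esym/bb.
move=> bb.
have on_eq m p : (m <= n)%N -> on beta m p = on beta' m p.
  rewrite /on => mn; case: leqP => // pm /=; apply: bb; rewrite ltnS.
  have pn := leq_trans pm mn.
  apply: (leq_trans _ (leq_bigmax (Ordinal (mn : m < n.+1)%N))) => /=.
  by apply: (leq_trans _ (leq_bigmax (Ordinal (pn : p < n.+1)%N))).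
move=> /asboolP[p [onp nearp cons]]; apply/asboolP; exists p; split=> //.
  by rewrite -on_eq.
by move=> n' p' n'n; rewrite -on_eq ?(ltnW n'n)//; exact: cons.
Qed.

(** [beta] requests, at a time [n a] in [J], a point within [eps a] of a fixed preimage [y] of [x].
    Such requests are mutually consistent by the triangle inequality through [y], and [y] itself
    witnesses each test. *)
Lemma range_test_complete C x J : unbounded J -> shrinks_to C x -> range f x ->
  exists beta, unbounded [set n | J n /\ range_test (C n) n beta].
Proof.
have [_ _ dsym dtri] := dm.
move=> Junb [Cx _] [y _ fyx]; have [p pP] := choice (fun a => q_dense a y).
have nex a : exists n, [/\ (maxn (p a) a <= n)%N & J n].
  by have [n pn Jn] := Junb (maxn (p a) a); exists n.
have [n nP] := choice nex.
pose beta k := `[< exists a, k = pickle (n a, p a) >].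
have onP m s : on beta m s -> exists2 a, m = n a & s = p a.
  rewrite /on => /andP[_ /asboolP[a /(pcan_inj pickleK)[-> ->]]].
  by exists a.
exists beta => N; exists (n N).
  by have [] := nP N; rewrite geq_max => /andP[].
split; first by have [] := nP N.
apply/asboolP; exists (p N); split.
- rewrite /on; apply/andP; split; last by apply/asboolP; exists N.
  by have [] := nP N; rewrite geq_max => /andP[].
- exists y; have [-> dy] := pP N; rewrite dsym; split=> //.
  by rewrite fyx.
- move=> _ _ /[swap] /onP[a -> ->] na; split.
    by rewrite !(pP _).1 => aN; move: na; rewrite aN ltnn.
  apply: le_lt_trans (dtri _ y _) _; rewrite (dsym _ y) !(pP _).1.
  by rewrite ltrD//; have [] := pP N; have [] := pP a.
Qed.

(** Successful requests at different times have different indices, so their radii become arbitrarily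
    small along a sequence of times. The centres are then Cauchy, and nearby points [y'] have images
    tending to [x], so the limit is a preimage of [x]. *)
Lemma range_test_sound C x beta : shrinks_to C x ->
  unbounded [set n | range_test (C n) n beta] -> range f x.
Proof.
have [d0 _ dsym dtri] := dm.
move=> [_ Csh] tests.
pose p n := xget 0%N (good (C n) n beta).
have pP n : range_test (C n) n beta -> good (C n) n beta (p n).
  by move=> /asboolP; exact: xgetPex.
pose acc n := (q (p n)).1.
(* Two passing times with index at least [m] have different indices, so one of the indices exceeds
   [m]. *)
have deep m N : exists2 n, (N <= n)%N & range_test (C n) n beta /\ (m <= acc n)%N.
  elim: m N => [|m IH] N; first by have [n Nn tn] := tests N; exists n.
  have [n Nn [tn mn]] := IH N; have [n' nn' [tn' mn']] := IH n.+1.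
  have [_ _ /(_ n (p n) nn')] := pP _ tn'; have [onp _ _] := pP _ tn.
  move=> /(_ onp)[neq _].
  have [mlt|mge] := ltnP m (acc n); first by exists n.
  exists n'; first exact: leq_trans Nn (ltnW nn').
  by split=> //; rewrite /acc in mn mge mn' *; lia.
have sex m : exists n, [/\ (m <= n)%N, range_test (C n) n beta & (m <= acc n)%N].
  by have [n mn [tn an]] := deep m m; exists n.
have [s sP] := choice sex.
pose c m := (q (p (s m))).2.
have c_dist m n N : (N <= m)%N -> (N <= n)%N -> d (c m) (c n) < eps N + eps N.
  move=> Nm Nn.
  have accN k : (N <= k)%N -> eps (acc (s k)) <= eps N :> R.
    by move=> Nk; apply: eps_le; have [_ _] := sP k; exact: leq_trans.
  (* Consistency compares a request with earlier ones, so the two are ordered by test times; equal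
     times give equal centres. *)
  wlog smn : m n Nm Nn / (s n <= s m)%N => [th|].
    have [/th|/ltnW/th] := leqP (s n) (s m); first exact.
    by rewrite dsym; exact.
  move: smn; rewrite leq_eqVlt => /predU1P[smn|smn].
    by rewrite /c smn (metricxx _ dm) addr_gt0// eps_gt0.
  have [_ tm _] := sP m; have [_ tn _] := sP n.
  have [_ _ /(_ _ (p (s n)) smn)] := pP _ tm; have [onp _ _] := pP _ tn.
  by move=> /(_ onp)[_ /lt_le_trans]; apply; rewrite lerD// accN.
have [|y cy] := dcpl (u := c).
  move=> r r0; have r2 : 0 < r / 2 by rewrite divr_gt0.
  have [N NP] := eps_lt r2; exists N => m n Nm Nn.
  by apply: lt_trans (c_dist _ _ _ Nm Nn) _; rewrite (splitr r) ltrD// NP.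
have yex m : exists y', d (c m) y' < eps m /\ C (s m) (f y').
  have [_ tm am] := sP m; have [_ [y' [dy Cy]] _] := pP _ tm.
  by exists y'; split=> //; apply: lt_le_trans dy _; exact: eps_le.
have [y' y'P] := choice yex.
have y'y : y' @ \oo --> y.
  apply/(metric_cvgP _ _ dc) => r r0; have r2 : 0 < r / 2 by rewrite divr_gt0.
  have [N NP] := eps_lt r2; move/(metric_cvgP _ _ dc): cy => /(_ _ r2)[M MP].
  exists (maxn N M) => n; rewrite geq_max => /andP[Nn Mn].
  apply: le_lt_trans (dtri _ (c n) _) _; rewrite (splitr r) ltrD ?MP//.
  exact: lt_trans (y'P n).1 (NP _ Nn).
exists y => //; apply: (cvg_unique W_hausdorff (F := f \o y' @ \oo)).
  exact: (cvg_comp _ _ y'y (@f_cont y)).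
move=> U /Csh[N NP]; exists N => // m /= Nm; apply: (NP (s m)).
  by have [ms _ _] := sP m; exact: leq_trans ms.
exact: (y'P m).2.
Qed.

End nonempty.

(** The tests are fixed before [C], [x] and [J], so the same tests serve along any infinite set of
    times, and the one at time [n] consults [C n] alone. *)
Lemma Sigma11_test (W : topologicalType) (A : set W) :
  hausdorff_space W -> Sigma11 R A ->
  exists (t : set W -> nat -> (nat -> bool) -> bool) (b : nat -> nat),
    (forall C n, determined_by (b n) (t C n)) /\
    forall C x J, shrinks_to C x -> unbounded J ->
      A x <-> exists beta, unbounded [set n | J n /\ t (C n) n beta].
Proof.
move=> Wh [Y [/polishP[d [J0 [e [dm dc dcpl de]]]] [f fc ->]]].
have [[y0 _]|Y0] := pselect (exists y : Y, True); last first.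
  exists (fun _ _ _ => false), (fun=> 0%N); split=> // C x J _ _.
  split=> [[y]|[beta /(_ 0%N)[n _ []]]//].
  by exfalso; apply: Y0; exists y.
pose q k : nat * Y :=
  if unpickle k is Some (a, j) then (a, odflt y0 (e j)) else (0%N, y0).
have qd a y : exists p, (q p).1 = a /\ d y (q p).2 < eps a.
  have [j [y' [ej dy]]] := de y _ (@eps_gt0 R a).
  by exists (pickle (a, j)); rewrite /q pickleK/= ej.
eexists (range_test f d q), _; split=> [C n|C x J Cx Junb].
  exact: range_test_determined.
split; first exact: range_test_complete.
move=> [beta tbeta]; apply: (range_test_sound Wh fc dm dc dcpl Cx (q := q) (beta := beta)).
by move=> N; have [n Nn []] := tbeta N; exists n.
Qed.

End analytic_test.

(** * Martingales of clopen sets *)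

Section clopen_martingales.
Variable R : realType.

Fixpoint average (g : seq bool -> R) (n : nat) (s : seq bool) : R :=
  if n is m.+1 then (average g m (rcons s false) + average g m (rcons s true)) / 2
  else g s.

(* The conditional expectation given [s] of the indicator function of the clopen
   set [t], where [t] depends on the first [b] coordinates only. *)
Definition clopen_average (b : nat) (t : (nat -> bool) -> bool) (s : seq bool) : R :=
  average (fun s' => (t (nth false s'))%:R) (b - size s) s.

Lemma clopen_averageE b t beta l : determined_by b t -> (b <= l)%N ->
  clopen_average b t (mkseq beta l) = (t beta)%:R.
Proof.
move=> tb bl; rewrite /clopen_average size_mkseq.
move: (bl); rewrite -subn_eq0 => /eqP -> /=; congr (_ (nat_of_bool _)).
by apply: tb => i ib; rewrite nth_mkseq// (leq_trans ib).
Qed.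

Lemma clopen_average_martingale b t :
  determined_by b t -> martingale (clopen_average b t : {ptws seq bool -> R}).
Proof.
move=> tb; split=> s.
  rewrite /clopen_average; move: (b - size s)%N => n; elim: n s => [|n IH] s /=.
    by rewrite ler0n lern1 leq_b1.
  have := IH (rcons s false); have := IH (rcons s true); lra.
rewrite /clopen_average !size_rcons.
have [bs|sb] := leqP b (size s); last by rewrite -subnSK.
have -> : (b - size s)%N = 0%N by apply/eqP; rewrite subn_eq0.
have -> : (b - (size s).+1)%N = 0%N by apply/eqP; rewrite subn_eq0 ltnW.
have tE x : t (nth false (rcons s x)) = t (nth false s).
  by apply: tb => i ib; rewrite nth_rcons (leq_trans ib bs).
by rewrite /= !tE mulrDl -splitr.
Qed.

(** Since [G z k] is locally constant in [z], so is the [k]-th martingale, which makes each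
    coordinate of [g] continuous. *)
Lemma continuous_clopen_reduction (Z : topologicalType)
    (G : Z -> nat -> (nat -> bool) -> bool) (b : nat -> nat) :
  (forall z k, determined_by (b k) (G z k)) ->
  (forall k z, \forall z' \near z, G z' k = G z k) ->
  exists2 g : Z -> martingale_seq_space R, continuous g &
    forall z k, everywhere_converging (g z k) /\
      forall beta, psi (g z k) beta = (G z k beta)%:R.
Proof.
move=> Gb Gloc.
pose g z : martingale_seq_space R :=
  fun k => exist (fun f => f \in @martingale R) _
    (mem_set (clopen_average_martingale (Gb z k))).
have gcvg z k beta : along (g z k) beta @ \oo --> ((G z k beta)%:R : R).
  apply: cvg_near_cst; exists (b k) => // l /= bl.
  by apply: clopen_averageE.
exists g => [|z k].
  apply: continuous_ptws => k z A nA; have Az := nbhs_singleton nA.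
  apply: filterS (Gloc k z) => z' zz' /=.
  suff : g z' k = g z k by rewrite /preimage/= => ->.
  by apply: val_inj => /=; rewrite zz'.
split=> beta; first by apply/cvg_ex; exists (G z k beta)%:R; exact: gcvg.
exact: (cvg_lim (@Rhausdorff R) (gcvg z k beta)).
Qed.

Lemma bool_ncvg0P (B : nat -> bool) :
  ~ ((fun k => (B k)%:R : R) @ \oo --> (0 : R)) <-> unbounded [set k | B k].
Proof.
rewrite ncvg0P; split=> [[j jP] N|BP].
  have [n Nn] := jP N; rewrite subr0; case Bn: (B n); first by exists n.
  by rewrite normr0 leNgt eps_gt0.
exists 0%N => N; have [n Nn /= Bn] := BP N; exists n => //.
by rewrite Bn subr0 normr1 eps_le1.
Qed.

Lemma bool_cvgP (B : nat -> bool) : (forall k, odd k -> ~~ B k) ->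
  cvgn (fun k => (B k)%:R : R) <-> ~ unbounded [set k | B k].
Proof.
move=> Bodd; split=> [Bc Bu|Bu]; last first.
  by apply/cvg_ex; exists 0; apply: contrapT => /bool_ncvg0P.
suff /ncvgP : exists j, forall N, exists2 n, (N <= n)%N &
  eps j <= `|(B n)%:R - (B N)%:R| :> R by [].
exists 0%N => N; case BN: (B N); last first.
  by have [n Nn /= Bn] := Bu N; exists n => //; rewrite Bn subr0 normr1 eps_le1.
(* An odd index past [N], where [B] vanishes. *)
exists N.*2.+1; first lia.
have /negbTE -> : ~~ B N.*2.+1 by apply: Bodd; rewrite /= odd_double.
by rewrite sub0r normrN normr1 eps_le1.
Qed.

End clopen_martingales.

(** * Countable clopen bases and their cells *)

Section clopen_cells.
Variable R : realType.
Variable Z : topologicalType.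

(** For each dense point and pair of radii, one clopen set lying between the two balls is chosen if
    there is any; these countably many sets form a basis. *)
Lemma countable_clopen_basis : polish R Z -> clopen_basis Z ->
  exists2 U : nat -> set Z, (forall n, clopen (U n)) &
    forall z V, nbhs z V -> exists2 n, U n z & U n `<=` V.
Proof.
move=> /polishP[d [J [e [[d0 deq dsym dtri] dc _ de]]]] [_ cb].
pose between (jab : J * nat * nat) : set (set Z) := [set S | clopen S /\
  exists y, [/\ e jab.1.1 = Some y, [set z | d y z < eps jab.1.2] `<=` S &
    S `<=` [set z | d y z < eps jab.2]]].
pose U k := if unpickle k is Some jab then xget setT (between jab) else setT.
exists U => [k|z V /dc[r r0 rV]].
  have cT : clopen [set: Z] by split; [exact: openT|exact: closedT].
  by rewrite /U; case: unpickle => // jab; case: xgetP => // S _ [].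
have r2 : 0 < r / 2 by rewrite divr_gt0.
(* [eps b < r / 2] keeps the chosen set inside the [r]-ball of [z]; [a] is later taken so small that
   [S0] itself lies between the balls of radii [eps a] and [eps b] about [y], so a choice exists. *)
have [b br] := eps_lt r2; have {}br := br _ (leqnn b).
have b2 : 0 < eps b / 2 :> R by rewrite divr_gt0// eps_gt0.
have [S0 [S0c S0z] S0b] := cb z _ (metric_nbhs z dc b2).
have : nbhs z S0 by apply: open_nbhs_nbhs; split=> //; exact: S0c.1.
move=> /dc[r1 r10 r1S0].
have [|a ar] := @eps_lt R (Num.min (r1 / 2) (eps b / 2)).
  by rewrite lt_min b2 divr_gt0.
have {ar} := ar _ (leqnn a); rewrite lt_min => /andP[ar ab].
have [j [y [ej dzy]]] := de z _ (@eps_gt0 R a).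
have : exists S, between (j, a, b) S.
  exists S0; split=> //; exists y; split=> // [x /= dyx|x /S0b /= dzx].
    by apply: r1S0 => /=; have := dtri z y x; lra.
  by have := dtri y z x; rewrite (dsym y z); lra.
move=> /(xgetPex setT)[_ [y' [/=]]]; rewrite ej => -[<-] yS Sy.
have UE : U (pickle (j, a, b)) = xget setT (between (j, a, b)).
  by rewrite /U pickleK.
exists (pickle (j, a, b)); rewrite UE; first by apply: yS; rewrite /= dsym.
by move=> x /Sy /= dyx; apply: rV => /=; have := dtri z y x; lra.
Qed.

(** The atom containing [z] of the algebra generated by the first [n] sets [U i]. *)
Definition cell (U : nat -> set Z) (n : nat) (z : Z) : set Z :=
  [set z' | forall i, (i < n)%N -> U i z' = U i z].

Variable U : nat -> set Z.
Hypothesis U_clopen : forall n, clopen (U n).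
Hypothesis U_basis : forall z V, nbhs z V -> exists2 n, U n z & U n `<=` V.

Lemma cell_nbhs n z : nbhs z (cell U n z).
Proof.
apply: (@near_all_lt _ (nbhs z) (fun i z' => U i z' = U i z)) => i.
have [Ui|Ui] := pselect (U i z).
  have : nbhs z (U i) by apply: open_nbhs_nbhs; split=> //; exact: (U_clopen i).1.
  by apply: filterS => z' Uz'; apply/propext.
have : nbhs z (~` U i).
  by apply: open_nbhs_nbhs; split=> //; apply: closed_openC; exact: (U_clopen i).2.
by apply: filterS => z' Uz'; apply/propext.
Qed.

Lemma cell_locally_constant n z : \forall z' \near z, cell U n z' = cell U n z.
Proof.
apply: filterS (cell_nbhs n z) => z' zz'; apply/seteqP.
by split=> x xz i ilt; rewrite xz// zz'.
Qed.

Lemma cell_shrinks z : shrinks_to (cell U ^~ z) z.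
Proof.
split=> // V /U_basis[n Uz UV]; exists n.+1 => m nm x xz.
by apply: UV; rewrite xz.
Qed.

End clopen_cells.

(** * Infinite chains of finite sequences *)

Section chains.

(* Finite sequences are stored with the last entry first, so that extension is
   consing, which strictly increases [CodeSeq.code], and initial segments are
   suffixes. *)
Definition proper_suffix (s t : seq nat) :=
  exists i, [/\ (0 < i)%N, (i <= size t)%N & s = drop i t].

Definition minimal (S : set (seq nat)) : set (seq nat) :=
  [set s | S s /\ forall s', S s' -> ~ proper_suffix s' s].

Lemma code_cons_gt n s : (CodeSeq.code s < CodeSeq.code (n :: s))%N.
Proof. by rewrite /=; have := expn_gt0 2 n; nia. Qed.

Lemma code_drop i s : (CodeSeq.code (drop i s) <= CodeSeq.code s)%N.
Proof.
elim: s i => [|n s IH] [|i] //.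
by rewrite drop_cons (leq_trans (IH i))// ltnW// code_cons_gt.
Qed.

Lemma size_le_code s : (size s <= CodeSeq.code s)%N.
Proof. by elim: s => //= n s IH; apply: leq_ltn_trans IH (code_cons_gt n s). Qed.

Lemma proper_suffix_size s t : proper_suffix s t -> (size s < size t)%N.
Proof. by move=> [i [i0 it ->]]; rewrite size_drop; lia. Qed.

Lemma proper_suffix_trans s t u :
  proper_suffix s t -> proper_suffix t u -> proper_suffix s u.
Proof.
move=> [i [i0 it ->]] [j [j0 ju tE]]; exists (i + j)%N.
by rewrite tE drop_drop; split=> //; move: it; rewrite tE size_drop; lia.
Qed.

Lemma above_minimal S t : S t -> minimal S t \/
  exists2 s, minimal S s & proper_suffix s t.
Proof.
have [n] := ubnP (size t); elim: n t => // n IH t tn St.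
have [tm|] := pselect (minimal S t); first by left.
move=> /not_andP[//|/existsNP[s /not_implyP[Ss /contrapT st]]]; right.
have sn : (size s < n)%N by have := proper_suffix_size st; lia.
have [sm|[m mm ms]] := IH _ sn Ss; first by exists s.
by exists m => //; exact: proper_suffix_trans ms st.
Qed.

(** Each element of [S] is minimal or above one of the finitely many minimal ones; if the elements
    above each of these had bounded codes, so would [S]. *)
Lemma unbounded_above (S : set (seq nat)) :
  unbounded (CodeSeq.code @` S) -> ~ unbounded (CodeSeq.code @` minimal S) ->
  exists2 s, S s &
    unbounded (CodeSeq.code @` [set t | S t /\ proper_suffix s t]).
Proof.
move=> Sunb /existsNP[N minN]; apply: contrapT => noS.
have bnd s : exists M, S s -> forall t, S t -> proper_suffix s t -> (CodeSeq.code t < M)%N.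
  have [Ss|nSs] := pselect (S s); last by exists 0%N.
  have : ~ unbounded (CodeSeq.code @` [set t | S t /\ proper_suffix s t]).
    by move=> unb; apply: noS; exists s.
  move=> /existsNP[M sM]; exists M => _ t St st; rewrite ltnNge.
  by apply/negP => Mt; apply: sM; exists (CodeSeq.code t) => //; exists t.
have [M MP] := choice bnd.
have minlt s : minimal S s -> (CodeSeq.code s < N)%N.
  move=> sm; rewrite ltnNge; apply/negP => Ns.
  by apply: minN; exists (CodeSeq.code s) => //; exists s.
(* A code of at least this sum is too large for a minimal element and for an element above one. *)
have [n + [t St tn]] := Sunb (N + \sum_(k < N) M (CodeSeq.decode k))%N.
rewrite -{}tn.
have [/minlt|[s sm st]] := above_minimal St; first lia.
have := MP s sm.1 t St st.
rewrite (bigD1 (Ordinal (minlt s sm)))//= CodeSeq.codeK; lia.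
Qed.

Definition initial (alpha : nat -> nat) n := rev (mkseq alpha n).

Lemma initialS alpha n : initial alpha n.+1 = alpha n :: initial alpha n.
Proof. by rewrite /initial /mkseq -addn1 iotaD map_cat rev_cat. Qed.

Lemma size_initial alpha n : size (initial alpha n) = n.
Proof. by rewrite size_rev size_mkseq. Qed.

Lemma proper_suffix_initial alpha m n :
  (m < n)%N -> proper_suffix (initial alpha m) (initial alpha n).
Proof.
move=> mn; exists (n - m)%N; rewrite size_initial; split; [lia|lia|].
elim: n mn => // n IH; rewrite ltnS leq_eqVlt initialS => /predU1P[->|mn].
  by rewrite subSnn /= drop0.
by rewrite subSn ?(ltnW mn)//= IH.
Qed.

Lemma initial_eqP alpha beta n :
  initial alpha n = initial beta n <-> forall i, (i < n)%N -> alpha i = beta i.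
Proof.
rewrite /initial; split=> [/(can_inj revK) ab i iltn|ab].
  by have /(congr1 (fun s => nth 0%N s i)) := ab; rewrite !nth_mkseq.
congr rev; apply: (@eq_from_nth _ 0%N); rewrite ?size_mkseq// => i iltn.
by rewrite !nth_mkseq// ab.
Qed.

(** Otherwise, for each [M], some sequence outside [Q] agrees with [alpha] up to [M], and these
    sequences converge to [alpha]. *)
Lemma initial_nbhs (alpha : baire_space) (Q : set baire_space) :
  nbhs alpha Q -> exists M, forall n, (M <= n)%N ->
    [set beta | initial beta n = initial alpha n] `<=` Q.
Proof.
move=> nQ; apply: contrapT => noM.
have ex M : exists beta : baire_space, initial beta M = initial alpha M /\ ~ Q beta.
  apply: contrapT => noa; apply: noM; exists M => n Mn beta /initial_eqP ab.
  apply: contrapT => nQb; apply: noa; exists beta; split=> //.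
  by apply/initial_eqP => i iM; apply: ab; exact: leq_trans Mn.
have [u uP] := choice ex.
suff /(_ _ nQ)[M _ /(_ M (leqnn M))] : u @ \oo --> alpha by exact: (uP M).2.
apply/cvg_ptws => i A /nbhs_singleton Ai; exists i.+1 => // n /= ni.
by have [/initial_eqP/(_ i ni) -> _] := uP n.
Qed.

Lemma branch_of_chain (c : nat -> seq nat) :
  (forall n, proper_suffix (c n) (c n.+1)) ->
  exists alpha, forall n, c n = initial alpha (size (c n)).
Proof.
move=> cP.
have cmono : forall m n, (m <= n)%N ->
    exists i, (i <= size (c n))%N /\ c m = drop i (c n).
  move=> m; elim=> [|n IH]; first by rewrite leqn0 => /eqP ->; exists 0%N; rewrite drop0.
  rewrite leq_eqVlt => /predU1P[->|/IH[i [ilt ->]]]; first by exists 0%N; rewrite drop0.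
  have [j [_ jlt cE]] := cP n; exists (i + j)%N; rewrite cE drop_drop; split=> //.
  by move: ilt; rewrite cE size_drop; lia.
have csize n : (n <= size (c n))%N.
  by elim: n => // n IH; apply: leq_ltn_trans IH (proper_suffix_size (cP n)).
have nthE m n k : (m <= n)%N -> (k < size (c m))%N ->
    nth 0%N (rev (c m)) k = nth 0%N (rev (c n)) k.
  move=> /cmono[i [isz ->]]; rewrite size_drop rev_drop => ksz.
  by rewrite nth_take.
(* Entry [n] is read in [c n.+1], whose length exceeds [n]. *)
exists (fun n => nth 0%N (rev (c n.+1)) n) => n.
rewrite -[LHS]revK /initial; congr rev.
apply: (@eq_from_nth _ 0%N); rewrite size_rev ?size_mkseq// => k ksz.
rewrite nth_mkseq//; have [nk|kn] := leqP n k.+1; first exact: nthE.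
by apply/esym/nthE; [exact: ltnW|exact: csize].
Qed.

(** Iterating [unbounded_above] on the part of [S] above the last point gives an infinite chain in
    [S]; the assumption on all subsets keeps the iteration going. *)
Lemma branch_in (S : set (seq nat)) :
  unbounded (CodeSeq.code @` S) ->
  (forall S', S' `<=` S -> ~ unbounded (CodeSeq.code @` minimal S')) ->
  exists alpha, unbounded [set n | S (initial alpha n)].
Proof.
move=> Sunb Smin.
pose above s := [set t | S t /\ proper_suffix s t].
pose rich s := S s /\ unbounded (CodeSeq.code @` above s).
have [s0 Ss0 s0unb] := unbounded_above Sunb (Smin _ (@subset_refl _ S)).
have next s : exists s', rich s -> rich s' /\ proper_suffix s s'.
  have [[Ss sunb]|nrich] := pselect (rich s); last by exists s.
  have aboveS : above s `<=` S by move=> t [].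
  have [s' [Ss' ss'] s'unb] := unbounded_above sunb (Smin _ aboveS).
  exists s' => _; split=> //; split=> // N; have [k Nk [t [[St _] s't] tk]] := s'unb N.
  by exists k => //; exists t.
have [nxt nxtP] := choice next.
pose c n := iter n nxt s0.
have cr n : rich (c n) by elim: n => [//|n IH]; have [] := nxtP _ IH.
have cs n : proper_suffix (c n) (c n.+1) by have [] := nxtP _ (cr n).
have [alpha alphaP] := branch_of_chain cs.
exists alpha => N; exists (size (c N)); last by rewrite /= -alphaP; exact: (cr N).1.
by elim: N => // N IH; apply: leq_ltn_trans IH (proper_suffix_size (cs N)).
Qed.

End chains.

(** * Hardness *)

Section hardness.
Variable R : realType.

(* The tests are interleaved with zero martingales, so that convergence of the
   sequence forces convergence to 0. *)
Lemma Pi11_hard (C : set (martingale_seq_space R)) :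
  seq_psi_cvg0 (R:=R) `<=` C -> C `<=` seq_psi_cvg (R:=R) ->
  forall Z : topologicalType, polish R Z -> clopen_basis Z ->
  forall D : set Z, Pi11 R D ->
  exists2 g : Z -> martingale_seq_space R, continuous g & D = g @^-1` C.
Proof.
move=> C0C CC Z Zp Zc D DPi.
have [U Uc Ub] := countable_clopen_basis Zp Zc.
have [t [b [tb tP]]] := Sigma11_test (polish_hausdorff Zp) DPi.
have [|k z|g gc gP] := @continuous_clopen_reduction R Z
  (fun z k beta => ~~ odd k && t (cell U k z) k beta) b.
- by move=> z k beta beta' bb; rewrite (tb _ _ _ _ bb).
- by apply: filterS (cell_locally_constant Uc k z) => z' ->.
exists g => //.
have even_unb : unbounded [set k | ~~ odd k].
  by move=> N; exists N.*2; rewrite /= ?odd_double//; lia.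
have DE z : D z <-> forall beta, ~ unbounded [set k | ~~ odd k && t (cell U k z) k beta].
  have := tP _ _ _ (cell_shrinks Ub z) even_unb; rewrite /setC/= => Dt.
  split=> [Dz beta bunb|nb].
    have /Dt : exists beta, unbounded [set n | ~~ odd n /\ t (cell U n z) n beta].
      by exists beta => N; have [n Nn /andP[? ?]] := bunb N; exists n.
    exact.
  apply: contrapT => /Dt[beta bunb]; apply: (nb beta) => N.
  by have [n Nn [on tn]] := bunb N; exists n => //=; rewrite on tn.
apply/seteqP; split=> z /=.
  move=> /DE zD; apply: C0C; split=> [k|beta]; first exact: (gP z k).1.
  rewrite (_ : (fun k => _) = fun k => (~~ odd k && t (cell U k z) k beta)%:R); last first.
    by apply/funext => k; rewrite (gP z k).2.
  by apply: contrapT => /bool_ncvg0P; exact: zD.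
move=> /CC[_ gz]; apply/DE => beta.
apply/(@bool_cvgP R) => [k ->//|].
rewrite (_ : (fun k => _) = fun k => psi (g z k) beta)//.
by apply/funext => k; rewrite (gP z k).2.
Qed.

Lemma Sigma12_hard (Z : topologicalType) : polish R Z -> clopen_basis Z ->
  forall D : set Z, Sigma12 R D ->
  exists2 g : Z -> martingale_seq_space R, continuous g &
    D = g @^-1` @seq_psi_subseq_cvg0 R.
Proof.
move=> Zp Zc D [B BPi DB].
have [U Uc Ub] := countable_clopen_basis Zp Zc.
have ZBh := polish_hausdorff (polish_prod Zp (polish_baire R)).
have [t [b [tb tP]]] := Sigma11_test ZBh BPi.
pose box z s : set (Z * baire_space) :=
  cell U (size s) z `*` [set alpha | initial alpha (size s) = s].
(* The [drop i s] with [i] from 1 to [size s] are the proper suffixes, so this says that [s] is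
   minimal in the set coded by [beta]. *)
pose first_hit (beta : nat -> bool) s := beta (CodeSeq.code s) &&
  ~~ has (fun i => beta (CodeSeq.code (drop i s))) (iota 1 (size s)).
pose hit z s beta := first_hit beta s || t (box z s) (size s) beta.
have [z k beta beta' bb|k z|g gc gP] := @continuous_clopen_reduction R Z
  (fun z k => hit z (CodeSeq.decode k))
  (fun k => maxn k.+1 (b (size (CodeSeq.decode k)))).
- have bb1 i : (i <= k)%N -> beta i = beta' i.
    by move=> ik; apply: bb; rewrite leq_max ltnS ik.
  rewrite /hit; congr (_ || _).
    rewrite /first_hit CodeSeq.decodeK bb1//; congr (_ && ~~ _).
    apply: eq_has => i; apply: bb1.
    by rewrite -{2}(CodeSeq.decodeK k) code_drop.
  by apply: tb => i ib; apply: bb; rewrite leq_max ib orbT.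
- apply: filterS (cell_locally_constant Uc (size (CodeSeq.decode k)) z) => z' zz'.
  by rewrite /hit /box zz'.
exists g => //.
have psi0 z (i : nat -> nat) beta : ((fun j => psi (g z (i j)) beta) @ \oo --> (0 : R)) <->
    ~ unbounded [set j | hit z (CodeSeq.decode (i j)) beta].
  rewrite (_ : (fun j => _) = fun j => (hit z (CodeSeq.decode (i j)) beta)%:R).
    by split=> [c0 /(@bool_ncvg0P R)//|nu]; apply: contrapT => /bool_ncvg0P.
  by apply/funext => j; rewrite (gP z (i j)).2.
have shr z alpha : shrinks_to (fun n => box z (initial alpha n)) (z, alpha).
  split=> [n|V [[P Q] /= [nP nQ] PQV]].
    by split; rewrite /= size_initial//; exact: (cell_shrinks Ub z).1.
  have [N NP] := (cell_shrinks Ub z).2 _ nP.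
  have [M MQ] := initial_nbhs nQ.
  exists (maxn N M) => n; rewrite geq_max => /andP[Nn Mn] [z' alpha'] [/=].
  rewrite size_initial => zz' aa'; apply: PQV; split=> /=.
    exact: NP zz'.
  exact: MQ aa'.
apply/seteqP; split=> z /=.
  rewrite DB => -[[z' alpha] Bza /= zz']; move: Bza; rewrite {}zz' => Bza.
  split=> [k|]; first exact: (gP z k).1.
  (* The subsequence runs along the initial segments of [alpha]. At most one of them is minimal in
     the set coded by [beta], so infinitely many hits would give infinitely many passed tests,
     although [(z, alpha)] is in [B]. *)
  exists (fun n => CodeSeq.code (initial alpha n)) => [|beta].
    by apply: (homo_ltn ltn_trans) => n; rewrite initialS code_cons_gt.
  apply/psi0 => unb; have setT_unb : unbounded [set: nat] by move=> N; exists N.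
  suff /(tP _ _ _ (shr z alpha) setT_unb) : exists beta, unbounded
      [set n | setT n /\ t (box z (initial alpha n)) n beta] by [].
  exists beta => N.
  have [n Nn] := unb N; rewrite /= CodeSeq.codeK /hit size_initial => /orP[fn|tn]; last by exists n.
  have [m nm] := unb n.+1; rewrite /= CodeSeq.codeK /hit size_initial => /orP[fm|tm]; last first.
    by exists m => //; exact: leq_trans Nn (ltnW nm).
  move: fm; rewrite /first_hit => /andP[_ /hasPn/(_ _ _)/negP fm].
  have [i [i0 isz nE]] := proper_suffix_initial alpha nm.
  exfalso; apply: (fm i); last by rewrite -nE; case/andP: fn.
  by rewrite mem_iota i0; move: isz; lia.
move=> [_ [i iinc i0]].
pose S := [set s | exists j, i j = CodeSeq.code s].
have ile m n : (i m <= i n -> m <= n)%N.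
  by apply: contraTT; rewrite -!ltnNge; exact: iinc.
have jle j : (j <= i j)%N by elim: j => // j IH; apply: leq_ltn_trans IH (iinc _ _ _).
have [||alpha alphaP] := @branch_in S.
- move=> N; exists (i N); first exact: jle.
  by exists (CodeSeq.decode (i N)); [exists N|]; rewrite CodeSeq.decodeK.
(* For [beta] the characteristic function of [S'], each minimal element of [S'] is a first hit, and
   convergence to 0 allows only finitely many. *)
- move=> S' S'S unb; have /psi0 := i0 (fun k => `[< S' (CodeSeq.decode k) >]); apply.
  move=> N; have [k Nk [s [S's smin] sk]] := unb (i N).
  have [j js] := S'S _ S's; exists j; first by apply: ile; rewrite js sk.
  rewrite /= js CodeSeq.codeK /hit /first_hit CodeSeq.codeK asboolT//=.
  apply/orP; left; apply/hasPn => l; rewrite mem_iota => /andP[l0 lsz].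
  rewrite CodeSeq.codeK; apply/negP => /asboolP S'l; apply: (smin _ S'l).
  by exists l; split=> //; lia.
(* If [(z, alpha)] were not in [B], then for some [beta] the tests at times [n] with
   [initial alpha n] in [S] would pass infinitely often, against convergence to 0 along [i]. *)
rewrite DB; exists (z, alpha) => //; apply: contrapT => nB.
have [+ _] := tP _ _ _ (shr z alpha) alphaP => /(_ nB)[beta unb].
have /psi0 := i0 beta; apply => N.
(* A sequence longer than [i N] has a code above [i N], which forces [j] to be at least [N]. *)
have [n Nn [[j jn] tn]] := unb (i N).+1; exists j.
  apply: ile; rewrite jn; apply: leq_trans (size_le_code _).
  by rewrite size_initial ltnW.
by rewrite /= jn CodeSeq.codeK /hit size_initial tn orbT.
Qed.

End hardness.

Theorem theorem1p8 (R : realType) :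
  [/\ complete_for R (@Pi11 R) (@seq_psi_cvg R),
      complete_for R (@Pi11 R) (@seq_psi_cvg0 R) &
      complete_for R (@Sigma12 R) (@seq_psi_subseq_cvg0 R)].
Proof.
have cvg0_cvg : @seq_psi_cvg0 R `<=` @seq_psi_cvg R.
  by move=> f [fP f0]; split=> // beta; apply/cvg_ex; exists 0; exact: f0.
split; split.
- exact: Pi11_seq_psi_cvg.
- exact: Pi11_hard.
- exact: Pi11_seq_psi_cvg0.
- exact: Pi11_hard.
- exact: Sigma12_seq_psi_subseq_cvg0.
- exact: Sigma12_hard.
Qed.
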